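(* Let $(S,\cdot)$ be a commutative semigroup with identity. Then $$M(\beta S,\mathcal{F}_{(S,\cdot)})=\overline{K(\beta S,\odot)},$$ where the bar denotes closure in the Stone topology of $\beta S$.
   Context: $\mathcal{F}_{(S,\cdot)}$ is the family of all functions $f_r:S\to S$, $f_r(s)=s\cdot r$, for $r\in S$. For $A,B\subseteq S$ and a family $\mathcal{F}$ of functions $S\to S$, $A\leq_{\mathcal{F}}B$ means that for every finite $F\subseteq A$ there is $f\in\mathcal{F}$ with $f(F)\subseteq B$. For $\mathcal{U},\mathcal{V}\in\beta S$, $\mathcal{U}\leq_{\mathcal{F}}\mathcal{V}$ means that for every $B\in\mathcal{V}$ there is $A\in\mathcal{U}$ with $A\leq_{\mathcal{F}}B$. $M(\beta S,\mathcal{F})$ is the set of maximal ultrafilters, i.e. those $\mathcal{U}\in\beta S$ such that $\mathcal{V}\leq_{\mathcal{F}}\mathcal{U}$ for every $\mathcal{V}\in\beta S$. The operation on $\beta S$ is $\mathcal{U}\odot\mathcal{V}=\{A\subseteq S\mid\{s\in S\mid\{r\in S\mid s\cdot r\in A\}\in\mathcal{V}\}\in\mathcal{U}\}$, and $K(\beta S,\odot)$ is the smallest two-sided ideal of $(\beta S,\odot)$. *)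

(* Defs.v *)
From HB Require Import structures.
From mathcomp Require Import all_boot.
From mathcomp Require Import all_classical.
From mathcomp Require Import topology.

Set Implicit Arguments.
Unset Strict Implicit.
Unset Printing Implicit Defensive.

Local Open Scope classical_set_scope.

(* [{beta T}] is the set of ultrafilters on T, principal ones included. *)
Structure ultrafilter_on (T : Type) := UltrafilterOn {
  ultrafilter :> (T -> Prop) -> Prop;
  ultrafilter_class : UltraFilter ultrafilter
}.
#[global] Existing Instance ultrafilter_class.

Notation "{ 'beta' T }" := (ultrafilter_on T)
  (at level 0, T at level 100, format "{ 'beta'  T }") : type_scope.

HB.instance Definition _ (T : Type) := gen_eqMixin {beta T}.
HB.instance Definition _ (T : Type) := gen_choiceMixin {beta T}.

Lemma ultrafilter_eq (T : Type) (U V : {beta T}) :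
  (forall A : set T, U A <-> V A) -> U = V.
Proof.
case: U V => [u uP] [v vP] /= uv.
have e : u = v by apply/funext => A; apply/propext; exact: uv.
by subst v; congr UltrafilterOn; exact: Prop_irrelevance.
Qed.

Section stone_topology.
Variable T : Type.

(* The Stone topology has the base of sets [set U | A \in U], A ranging over
   the subsets of T. *)
Definition stone_base (A : set T) : set {beta T} := [set U | U A].

Lemma stone_base_cover : \bigcup_(A in [set: set T]) stone_base A = setT.
Proof. by rewrite -subTset => U _; exists setT => //; exact: filterT. Qed.

Lemma stone_base_join (A B : set T) (U : {beta T}) :
  [set: set T] A -> [set: set T] B -> stone_base A U -> stone_base B U ->
  exists C, [/\ [set: set T] C, stone_base C U
              & stone_base C `<=` stone_base A `&` stone_base B].
Proof.
move=> _ _ UA UB; exists (A `&` B); split=> //; first exact: (filterI (F := U)).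
by move=> V; rewrite /stone_base /= => VAB; split; apply: filterS VAB => x [].
Qed.

HB.instance Definition _ := @isBaseTopological.Build {beta T}
  (set T) [set: set T] stone_base stone_base_cover stone_base_join.

End stone_topology.

Local Open Scope group_scope.

Section ultrafilter_product.
Variable S : magmaType.

Definition ultra_mul_sets (U V : {beta S}) : set (set S) :=
  [set A : set S | U [set s | V [set r | A (s * r)]]].

Lemma ultra_mul_subproof (U V : {beta S}) : UltraFilter (ultra_mul_sets U V).
Proof.
have PF : ProperFilter (ultra_mul_sets U V).
  split.
    have nU : ~ U set0 := filter_not_empty U.
    have nV : ~ V set0 := filter_not_empty V.
    rewrite /ultra_mul_sets /= => U0; apply: nU; apply: filterS U0 => s; exact: nV.
  split; rewrite /ultra_mul_sets /=.
  - apply: (@filterS _ U _ setT); last exact: filterT.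
    by move=> s _; exact: (@filterT _ V).
  - move=> A B UA UB; apply: (@filterS2 _ U _ _ _ _ _ UA UB) => s VA VB.
    exact: (@filterI _ V _ _ _ VA VB).
  - move=> A B AB; apply: (@filterS _ U) => s; apply: (@filterS _ V) => r.
    exact: AB.
split=> // G PG subG; apply/seteqP; split=> // A GA.
have [UA|UnA] := in_ultra_setVsetC [set s | V [set r | A (s * r)]]
  (ultrafilter_class U); first exact: UA.
suff /subG GnA : ultra_mul_sets U V (~` A).
  have nG : ~ G set0 := filter_not_empty G.
  by exfalso; apply: nG; rewrite -(setICr A); exact: filterI.
apply: filterS UnA => s /= VnA.
by have [//|] := in_ultra_setVsetC [set r | A (s * r)] (ultrafilter_class V).
Qed.

Definition ultra_mul (U V : {beta S}) : {beta S} :=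
  UltrafilterOn (ultra_mul_subproof U V).

End ultrafilter_product.

Lemma ultra_mulA (S : semigroupType) : associative (@ultra_mul S).
Proof.
move=> U V W; apply: ultrafilter_eq => A; rewrite /= /ultra_mul_sets /=.
suff -> : (fun s => V [set s' | W [set r | A (s * (s' * r))]]) =
  (fun s => V [set s' | W [set r | A (s * s' * r)]]) by [].
apply/funext => s; congr (ultrafilter V _); apply/funext => s'.
by congr (ultrafilter W _); apply/funext => r /=; rewrite mulgA.
Qed.

HB.instance Definition _ (S : semigroupType) :=
  isSemigroup.Build {beta S} (@ultra_mulA S).

(* Nonemptiness is part of the definition: otherwise the smallest ideal, which
   is the intersection of all ideals, would be empty. *)
Definition two_sided_ideal (G : semigroupType) (I : set G) : Prop :=
  I !=set0 /\ forall x y : G, I y -> I (x * y) /\ I (y * x).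

Definition smallest_ideal (G : semigroupType) : set G :=
  smallest (@two_sided_ideal G) set0.
Arguments smallest_ideal : clear implicits.

Section finite_embeddability.
Variable S : Type.
Implicit Types F : set (S -> S).

Definition set_le F (A B : set S) : Prop :=
  forall X : set S, finite_set X -> X `<=` A ->
    exists2 f : S -> S, F f & f @` X `<=` B.

Definition ultra_le F (U V : {beta S}) : Prop :=
  forall B : set S, V B -> exists2 A : set S, U A & set_le F A B.

Definition max_ultrafilters F : set {beta S} :=
  [set U | forall V : {beta S}, ultra_le F V U].

End finite_embeddability.

Definition translations (S : magmaType) : set (S -> S) :=
  range (fun r s : S => s * r).
Arguments translations : clear implicits.

(* Main.v *)
Require Import Defs.
From mathcomp Require Import all_boot all_classical topology.
From mathcomp Require Import finmap.

(** Compactness of [beta S] gives [V <= U] iff every [B] in [U] belongs to some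
    product [V * W].  If [u] lies in the smallest ideal [K], it lies in the
    ideal [beta S * V * beta S], say [u = P * V * Q]; a set [B] in [u] is then
    in [p * V * Q = V * p * Q] for some point [p], as points commute with
    everything.  Conversely, applied to some [V] in [K], maximality of [U]
    puts each [B] in [U] in some [V * W], which belongs to [K].  This needs [K]
    nonempty.  Closed left ideals correspond to proper filters stable under
    the preimages of left translations, so Zorn's lemma gives a maximal such
    filter, that is, a minimal left ideal, and the latter is contained in
    every two-sided ideal. *)

Local Open Scope classical_set_scope.
Local Open Scope group_scope.

Lemma ultra_exists (T : Type) (F : set (set T)) :
  ProperFilter F -> exists U : {beta T}, F `<=` U.
Proof.
move=> FF; have [G [GU FG]] := ultraFilterLemma FF.
by exists (UltrafilterOn GU).
Qed.

Lemma ultra_maximal (T : Type) (U V : {beta T}) : U `<=` V -> U = V.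
Proof.
move=> UV; apply: ultrafilter_eq => A; split=> [|VA]; first exact: UV.
have [//|/UV VnA] := in_ultra_setVsetC A (ultrafilter_class U).
by case: (filter_ex (filterI VA VnA)) => x [].
Qed.

Lemma closure_stoneP (T : Type) (E : set {beta T}) (U : {beta T}) :
  closure E U <-> forall B : set T, U B -> exists2 V, E V & V B.
Proof.
split=> [clU B UB|EU N].
  have [V [EV VB]] : E `&` stone_base B !=set0; last by exists V.
  apply: clU; rewrite nbhsE; exists (stone_base B) => //; split=> //.
  by exists [set B] => //; rewrite bigcup_set1.
rewrite nbhsE => -[O [[D _ <-] [B DB UB]] ON].
by have [V EV VB] := EU _ UB; exists V; split=> //; apply: ON; exists B.
Qed.

Section smallest_ideal.
Variable G : semigroupType.

Lemma smallest_ideal_mulr (x y : G) :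
  smallest_ideal G x -> smallest_ideal G (x * y).
Proof.
move=> Kx I idI; have Ix : I x := Kx I idI.
by have [] := idI.1.2 y x Ix.
Qed.

Lemma smallest_ideal_factor (x v : G) :
  smallest_ideal G x -> exists p q, x = p * v * q.
Proof.
have idv : @two_sided_ideal G [set x | exists p q, x = p * v * q].
  split; first by exists (v * v * v), v, v.
  move=> y _ [p [q ->]]; split; first by exists (y * p), q; rewrite !mulgA.
  by exists p, (q * y); rewrite mulgA.
by move=> /(_ _ (conj idv (@sub0set _ _))).
Qed.

End smallest_ideal.

Section invariant_filters.
Variable S : monoidType.
Implicit Types (F : set (set S)) (v w : {beta S}).

Definition left_invariant F :=
  forall (p : S) (A : set S), F A -> F [set r | A (p * r)].

(* The filter of sets belonging to every element of the closed left ideal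
   [beta S * v]. *)
Definition orbit_filter v : set (set S) :=
  [set A | forall p : S, v [set r | A (p * r)]].

Lemma orbit_filter_proper v : ProperFilter (orbit_filter v).
Proof.
split; first by move=> /(_ 1); exact: filter_not_empty.
split=> [p|A B vA vB p|A B AB vA p]; first exact: filterT.
- exact: filterI (vA p) (vB p).
- by apply: filterS (vA p) => r; exact: AB.
Qed.

Lemma orbit_filter_invariant v : left_invariant (orbit_filter v).
Proof.
move=> p A vA q; apply: filterS (vA (p * q)) => r /=.
by rewrite mulgA.
Qed.

Lemma orbit_filter_sub F v :
  left_invariant F -> F `<=` v -> F `<=` orbit_filter v.
Proof. by move=> Finv Fv A FA p; exact/Fv/Finv. Qed.

(** The last clause is maximality in usable form: [orbit_filter v] is itself a proper invariant
    filter containing [F], so it cannot be strictly larger. *)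
Lemma maximal_invariant_filter :
  exists F, [/\ ProperFilter F, left_invariant F &
    forall v, F `<=` v -> orbit_filter v `<=` F].
Proof.
(* Without [F setT], so that the empty chain has the empty union as bound. *)
pose P F := [/\ ~ F set0, (forall A B, F A -> F B -> F (A `&` B)),
  (forall A B : set S, A `<=` B -> F A -> F B) & left_invariant F].
have [C CP totC|F [[F0 FI FS Finv] Fmax]] := @Zorn_bigcup _ P.
  split.
  - by move=> [F CF]; case: (CP _ CF).
  - move=> A B [F CF FA] [H CH HB]; have [_ FI _ _] := CP _ CF.
    have [_ HI _ _] := CP _ CH.
    have [FH|HF] := totC _ _ CF CH; first by exists H => //; exact/HI/HB/FH.
    by exists F => //; exact/FI/HF.
  - move=> A B AB [F CF FA]; exists F => //; have [_ _ FS _] := CP _ CF.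
    exact: FS FA.
  - move=> p A [F CF FA]; exists F => //; have [_ _ _ Finv] := CP _ CF.
    exact: Finv.
have FT : F setT.
  (* Without [setT], the upward closed [F] is empty, hence strictly below the trivial filter. *)
  apply: contrapT => nFT; apply: (Fmax [set setT]); last split.
  - split=> [A FA|TF]; last by apply: nFT; exact: TF.
    by exfalso; apply: nFT; exact: FS FA.
  - by move=> /= /seteqP[_ /(_ 1)]; exact.
  - by move=> _ _ -> ->; rewrite setIT.
  - by move=> A B AB /= AT; rewrite -subTset -[X in X `<=` _]AT.
  - by move=> p A /= ->.
exists F; split=> //.
move=> v Fv; apply: contrapT => vF; apply: (Fmax (orbit_filter v)).
  by split=> //; exact: orbit_filter_sub.
have vP := orbit_filter_proper v; split.
- exact: filter_not_empty.
- by move=> A B; exact: filterI.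
- by move=> A B; exact: filterS.
- exact: orbit_filter_invariant.
Qed.

(* If no [q * w] were [v], some [A] in [v] would have every preimage
   [[set r | A (p * r)]] outside [w], hence [~` A] in [orbit_filter w]. *)
Lemma ultra_mul_transitive F v w :
  orbit_filter w `<=` F -> F `<=` v -> exists q : {beta S}, v = q * w.
Proof.
move=> wF Fv.
(* [A] lies in [q * w] exactly when its generator here lies in [q]. *)
pose H := filter_from v (fun A : set S => [set p | w [set r | A (p * r)]]).
have HF : ProperFilter H.
  apply: filter_from_proper => [|A vA].
    apply: filter_from_filter; first by exists setT; exact: filterT.
    move=> A B vA vB; exists (A `&` B); first exact: filterI.
    by move=> p /= wAB; split; apply: filterS wAB => r [].
  apply: contrapT => /nonemptyPn Ae.
  have : v (~` A).
    apply/Fv/wF => p.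
    have [wA|//] := in_ultra_setVsetC [set r | A (p * r)] (ultrafilter_class w).
    by exfalso; have : set0 p by rewrite -Ae.
  by move=> /(filterI vA) /filter_ex[x []].
have [q Hq] := ultra_exists _ _ HF.
by exists q; apply: ultra_maximal => A vA; apply: Hq; exists A.
Qed.

Lemma smallest_ideal_nonempty : smallest_ideal {beta S} !=set0.
Proof.
have [F [FF Finv Fmin]] := maximal_invariant_filter.
have [v Fv] := ultra_exists _ _ FF.
exists v => I [[[i Ii] idI] _].
(* [i * v] lies both in [I] and in the minimal left ideal, so [v] is a left multiple of it and falls
   into [I]. *)
have Fiv : F `<=` (i * v : {beta S}).
  move=> A FA; apply: (@filterS _ i _ setT); last exact: filterT.
  by move=> s _; exact/Fv/Finv.
have [q ->] := ultra_mul_transitive _ _ _ (Fmin _ Fiv) Fv.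
exact: (idI _ _ (idI _ _ Ii).2).1.
Qed.

End invariant_filters.

(** Compactness: the sets of [r] translating a given finite part of [A] into [B] are nonempty and
    directed, so some ultrafilter contains them all. Conversely, finitely many members of [W] share
    a point. *)
Lemma set_le_translationsP (S : monoidType) (A B : set S) :
  set_le (translations S) A B <->
  exists W : {beta S}, forall a, A a -> W [set r | B (a * r)].
Proof.
split=> [AB|[W WB] X /finite_fsetP[D ->] DA].
  pose H := filter_from [set X : set S | finite_set X /\ X `<=` A]
    (fun X => [set r | forall a, X a -> B (a * r)]).
  have HF : ProperFilter H.
    apply: filter_from_proper => [|X [finX XA]].
      apply: filter_from_filter.
        by exists set0; split; [exact: finite_set0|exact: sub0set].
      move=> X Y [finX XA] [finY YA]; exists (X `|` Y).
        by split; [rewrite finite_setU|rewrite subUset].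
      by move=> r XYr; split=> a ?; apply: XYr; [left|right].
    have [_ [r _ <-] XB] := AB X finX XA.
    by exists r => a Xa; apply: XB; exists a.
  have [W HW] := ultra_exists _ _ HF; exists W => a Aa; apply: HW.
  exists [set a]; last by move=> r; exact.
  by split; [exact: finite_set1|move=> _ ->].
have /filter_ex[r Br] : W (\bigcap_(a in [set` D]) [set r | B (a * r)]).
  by apply: filter_bigI => a aD; exact/WB/DA.
exists (fun s => s * r); first by exists r.
by move=> _ [a aD <-]; exact: Br.
Qed.

Lemma ultra_le_translationsP (S : monoidType) (U V : {beta S}) :
  ultra_le (translations S) V U <->
  forall B : set S, U B -> exists W : {beta S}, (V * W : {beta S}) B.
Proof.
split=> VU B /VU.
  move=> [A VA /set_le_translationsP[W WB]].
  by exists W; apply: (@filterS _ V _ A) => // a; exact: WB.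
(* The largest set that [W] sends into [B]; it is in [V] by definition of the product. *)
move=> [W VWB]; exists [set s | W [set r | B (s * r)]] => //.
by apply/set_le_translationsP; exists W.
Qed.

(** [W] is the image of [Q] under left translation by [p], that is, the principal ultrafilter at [p]
    times [Q]. *)
Lemma ultra_map_mull (S : monoidType) (p : S) (Q : {beta S}) :
  exists W : {beta S}, forall A : set S, Q [set r | A (p * r)] -> W A.
Proof.
have FF : ProperFilter [set A : set S | Q [set r | A (p * r)]].
  split; first exact: filter_not_empty.
  split=> [|A B|A B AB]; first exact: filterT.
  - exact: filterI.
  - by apply: filterS => r; exact: AB.
by have [W] := ultra_exists _ _ FF; exists W.
Qed.

Theorem theorem4p13 (S : monoidType)
    (mulC : forall x y : S, (x * y = y * x)%g) :
  max_ultrafilters (translations S) = closure (smallest_ideal {beta S}).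
Proof.
apply/seteqP; split=> U.
  move=> Umax; have [v Kv] := smallest_ideal_nonempty S.
  apply/closure_stoneP => B UB.
  have /ultra_le_translationsP/(_ B UB)[W vWB] := Umax v.
  by exists (v * W) => //; exact: smallest_ideal_mulr.
move=> /closure_stoneP clU V; apply/ultra_le_translationsP => B /clU[u Ku uB].
have [P [Q uE]] := smallest_ideal_factor _ _ V Ku.
have : P [set p | V [set s | Q [set r | B (p * (s * r))]]].
  by move: uB; rewrite uE -mulgA.
move=> /filter_ex[p VQB].
have [W QW] := ultra_map_mull S p Q; exists W.
apply: filterS VQB => s QB; apply: QW; apply: filterS QB => r /=.
(* Commutativity moves the point [p] past [s], from the left of [V] to its right. *)
by rewrite !mulgA (mulC s).
Qed.
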